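(* Let $N$ be a finite index set, let $X=(X_j)_{j\in N}\in H_N$ have the dual $Y=(Y_j)_{j\in N}\in H_N$, and let $K$, $\{l\}$, $M$ partition $N$, i.e. $N=K\cup\{l\}\cup M$ (disjoint union). Let $\Gamma=(\gamma_{i,j})_{i,j\in N}$, $\gamma_{i,j}=(X_i,X_j)$, be the covariance matrix of $X$ and write $\Gamma^{-1}=(\gamma^{i,j})_{i,j\in N}$. Then $$X_l-\hat X_l(K)=\sum_{i\in M\cup\{l\}}\alpha'_iY_i,\qquad \lVert X_l-\hat X_l(K)\rVert^2=\alpha'_l,$$ where $(\alpha'_i)_{i\in M\cup\{l\}}$ is the solution to the system of linear equations $$\sum_{i\in M\cup\{l\}}\alpha'_i\gamma^{i,j}=\delta_{lj},\qquad j\in M\cup\{l\}.$$ In particular, the prediction error variance $\sigma_l^2(K)=\lVert X_l-\hat X_l(K)\rVert^2$ is the $(l,l)$-entry of the inverse of the matrix $(\gamma^{i,j})_{i,j\in M\cup\{l\}}$, and the predictor coefficients $\alpha_k$ in $\hat X_l(K)=\sum_{k\in K}\alpha_kX_k$ are given by $$\alpha_k=-\sum_{i\in M\cup\{l\}}\alpha'_i\gamma^{i,k},\qquad k\in K,$$ whence $$\hat X_l(K)=-\sum_{k\in K}\Bigl(\sum_{i\in M\cup\{l\}}\alpha'_i\gamma^{i,k}\Bigr)X_k.$$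
   Context: Fix a probability space $(\Omega,\mathcal F,P)$. For complex-valued random variables in $L^2(\Omega,\mathcal F,P)$ use the inner product $(U,V):=E[U\overline V]$ and norm $\lVert U\rVert:=E[|U|^2]^{1/2}$. For a finite index set $N$, $H_N$ is the class of vectors $X=(X_j)_{j\in N}$ with $X_j\in L^2(\Omega,\mathcal F,P)$ and $E[X_j]=0$ for all $j\in N$. $\mathrm{sp}$ denotes (complex) linear span, with $\mathrm{sp}\,\emptyset=\{0\}$. Dual: for $X\in H_N$, a random vector $Y\in H_N$ is called the dual of $X$ if (i) $Y_j\in\mathrm{sp}\{X_k;k\in N\}$ for every $j\in N$, and (ii) $X$ and $Y$ are biorthogonal: $(X_i,Y_j)=\delta_{ij}$ for all $i,j\in N$. (Existence of a dual is equivalent to nonsingularity of the covariance matrix of $X$.) Predictor: for $X\in H_N$, $l\in N$ and $K\subset N$, $\hat X_l(K)$ denotes the orthogonal projection of $X_l$ onto $\mathrm{sp}\{X_k;k\in K\}$. *)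

(* Defs.v *)
From HB Require Import structures.
From mathcomp Require Import all_boot all_order all_algebra.
From mathcomp Require Import complex.
From mathcomp Require Import all_classical all_reals all_analysis.

Set Implicit Arguments.
Unset Strict Implicit.
Unset Printing Implicit Defensive.

Import Order.TTheory GRing.Theory Num.Theory.
Local Open Scope ring_scope.
Local Open Scope complex_scope.

(* Random variables are functions; the elements of L^2 are their classes modulo
   almost sure equality, so every identity between them is an [%[ae P]] one. *)
Section ComplexRandomVariables.
Context (d : measure_display) (Omega : measurableType d) (R : realType).
Variable P : probability Omega R.
Implicit Types U V : Omega -> R[i].

Definition in_L2 U : Prop :=
  (fun w => complex.Re (U w)) \in Lfun P 2%:E /\
  (fun w => complex.Im (U w)) \in Lfun P 2%:E.

(* The real expectations are [\bar R]-valued; [fine] is harmless below since it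
   is applied to integrable variables only. *)
Definition cexpectation U : R[i] :=
  fine 'E_P[fun w => complex.Re (U w)] +i* fine 'E_P[fun w => complex.Im (U w)].

Definition inner U V : R[i] := cexpectation (fun w => U w * (V w)^*).

Definition norm2 U : R :=
  Num.sqrt (fine 'E_P[fun w => ComplexField.Normc.normc (U w) ^+ 2]).

Variable N : finType.
Implicit Types (X Y : N -> Omega -> R[i]) (K : {set N}).

Definition in_H X : Prop := forall j, in_L2 (X j) /\ cexpectation (X j) = 0.

Definition in_sp X K U : Prop :=
  in_L2 U /\
  exists c : N -> R[i], U = (fun w => \sum_(k in K) c k * X k w) %[ae P].

Definition is_dual X Y : Prop :=
  [/\ in_H Y,
      forall j, in_sp X [set: N] (Y j)
    & forall i j, inner (X i) (Y j) = (i == j)%:R].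

(* V is (a version of) the orthogonal projection of U onto sp {X_k ; k in K} *)
Definition is_proj X K U V : Prop :=
  in_sp X K V /\
  forall W, in_sp X K W -> inner (fun w => U w - V w) W = 0.

Definition is_predictor X l K V : Prop := is_proj X K (X l) V.

(* Gamma; indices in N become ordinals through [enum_rank] / [enum_val] *)
Definition covmx X : 'M[R[i]]_#|N| :=
  \matrix_(i, j) inner (X (enum_val i)) (X (enum_val j)).

(* gamma^{i,j} *)
Definition invcov X (i j : N) : R[i] :=
  invmx (covmx X) (enum_rank i) (enum_rank j).

(* the matrix (gamma^{i,j})_{i,j in A} *)
Definition invcov_submx X (A : {set N}) : 'M[R[i]]_#|A| :=
  \matrix_(i, j) invcov X (enum_val i) (enum_val j).

(* a solves sum_{i in A} a_i gamma^{i,j} = delta_{lj}, j in A; the unknowns are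
   the a_i with i in A, other values of a are ignored *)
Definition solves X (A : {set N}) l (a : N -> R[i]) : Prop :=
  forall j, j \in A -> \sum_(i in A) a i * invcov X i j = (l == j)%:R.

End ComplexRandomVariables.

(* Main.v *)
(* Biorthogonality forces Y_i = sum_k gamma^{i,k} X_k, so a combination
   sum_k c_k X_k whose inner products with the X_j are b_j has coefficients
   c = b Gamma^{-1} and equals sum_j b_j Y_j. Apply this to the residual
   X_l - Xhat_l(K): its b vanishes on K by orthogonality, and its c is
   delta_l on the complement of K, so b restricted to this complement solves the
   linear system. All the formulas follow, once the system is known to have a
   unique solution. *)
Require Import Defs.
From HB Require Import structures.
From mathcomp Require Import all_boot all_order all_algebra.
From mathcomp Require Import complex.
From mathcomp Require Import all_classical all_reals all_analysis.
From mathcomp Require Import measurable_realfun ring.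

Set Implicit Arguments.
Unset Strict Implicit.
Unset Printing Implicit Defensive.

Import Order.TTheory GRing.Theory Num.Theory.
Local Open Scope ring_scope.
Local Open Scope complex_scope.

(** * Real expectation and the bilinear form $E[fg]$ on real $L^2$ *)

Section RealL2.
Context (d : measure_display) (Omega : measurableType d) (R : realType).
Variable P : probability Omega R.
Implicit Types f g h : Omega -> R.

Definition Exp f : R := fine 'E_P[f].

Lemma ExpD f g : f \in Lfun P 1 -> g \in Lfun P 1 ->
  Exp (fun w => f w + g w) = Exp f + Exp g.
Proof.
move=> f1 g1; rewrite /Exp -[fun w => _]/(f \+ g) expectationD//.
by rewrite fineD ?expectation_fin_num.
Qed.

Lemma ExpZ (a : R) f : f \in Lfun P 1 -> Exp (fun w => a * f w) = a * Exp f.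
Proof.
move=> f1; rewrite /Exp.
rewrite (_ : (fun w => a * f w) = a \o* f); last first.
  by apply/funext => w /=; rewrite mulrC.
by rewrite expectationZl// fineM ?expectation_fin_num.
Qed.

Lemma Lfun2D f g : f \in Lfun P 2%:E -> g \in Lfun P 2%:E ->
  (fun w => f w + g w) \in Lfun P 2%:E.
Proof.
have p1 : (1 <= 2%:E :> \bar R)%E by rewrite lee_fin ler1n.
exact: (Lfun_addr_closed P p1).2.
Qed.

Lemma Lfun2Z (a : R) f : f \in Lfun P 2%:E ->
  (fun w => a * f w) \in Lfun P 2%:E.
Proof.
move=> f2; rewrite (_ : (fun w => a * f w) = a \o* f); last first.
  by apply/funext => w /=; rewrite mulrC.
by apply: Lfun_scale => //; rewrite ler1n.
Qed.

Lemma Lfun2_measurable f : f \in Lfun P 2%:E -> measurable_fun setT f.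
Proof. by rewrite inE => /andP[]; rewrite inE. Qed.

Lemma Exp_ae f g : measurable_fun setT f -> measurable_fun setT g ->
  f = g %[ae P] -> Exp f = Exp g.
Proof.
move=> mf mg fg; rewrite /Exp unlock; congr fine.
apply: ae_eq_integral => //; last exact: (ae_eq_comp EFin fg).
  exact: (measurable_EFinP _ _).2 mf.
exact: (measurable_EFinP _ _).2 mg.
Qed.

(** Since [f] equals its absolute value, its integral is that of $|f|$, which vanishes only if [f]
    is almost surely zero. *)
Lemma Exp_eq0_ae f : f \in Lfun P 1 -> (forall w, 0 <= f w) -> Exp f = 0 ->
  f = cst 0 %[ae P].
Proof.
move=> f1 f0 Ef0.
have mf : measurable_fun setT f by move: f1; rewrite inE => /andP[]; rewrite inE.
have : ('E_P[f] = 0)%E by rewrite -(fineK (expectation_fin_num f1)) -/(Exp f) Ef0.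
rewrite unlock => I0.
have mEf : measurable_fun setT (EFin \o f) by exact/measurable_EFinP.
have h : ae_eq P setT (EFin \o f) (cst 0%E).
  apply: (iffLR (ae_eq_integral_abs P measurableT mEf)).
  rewrite -[RHS]I0; apply: eq_integral => w _ /=.
  by rewrite ger0_norm.
by apply: filterS h => w /[apply] -[].
Qed.

Definition dot f g : R := Exp (fun w => f w * g w).

Lemma dotC f g : dot f g = dot g f.
Proof. by congr Exp; apply/funext => w; rewrite mulrC. Qed.

Lemma dotDl f g h : f \in Lfun P 2%:E -> g \in Lfun P 2%:E ->
  h \in Lfun P 2%:E -> dot (fun w => f w + g w) h = dot f h + dot g h.
Proof.
move=> f2 g2 h2; rewrite /dot -ExpD; try exact: Lfun2_mul_Lfun1.
by congr Exp; apply/funext => w; rewrite mulrDl.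
Qed.

Lemma dotZl a f h : f \in Lfun P 2%:E -> h \in Lfun P 2%:E ->
  dot (fun w => a * f w) h = a * dot f h.
Proof.
move=> f2 h2; rewrite /dot -ExpZ; last exact: Lfun2_mul_Lfun1.
by congr Exp; apply/funext => w; rewrite mulrA.
Qed.

End RealL2.

(** * The sesquilinear inner product on complex $L^2$ *)

Section ComplexL2.
Context (d : measure_display) (Omega : measurableType d) (R : realType).
Variable P : probability Omega R.
Implicit Types U V W : Omega -> R[i].
Notation re U := (fun w => complex.Re (U w)).
Notation im U := (fun w => complex.Im (U w)).

Lemma ReD (x y : R[i]) : complex.Re (x + y) = complex.Re x + complex.Re y.
Proof. by case: x y => [a b] []. Qed.
Lemma ImD (x y : R[i]) : complex.Im (x + y) = complex.Im x + complex.Im y.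
Proof. by case: x y => [a b] []. Qed.
(** The sign sits on the imaginary part of [x] so that, for constant [x], the right-hand side is a
    sum of two real scalar multiples. *)
Lemma ReM (x y : R[i]) : complex.Re (x * y) =
  complex.Re x * complex.Re y + (- complex.Im x) * complex.Im y.
Proof. by case: x y => [a b] [c e] /=; rewrite mulNr. Qed.
Lemma ImM (x y : R[i]) : complex.Im (x * y) =
  complex.Re x * complex.Im y + complex.Im x * complex.Re y.
Proof. by case: x y => [a b] []. Qed.

Lemma in_L2_0 : in_L2 P (fun _ => 0).
Proof. by split; exact: Lfun_cst. Qed.

Lemma in_L2D U V : in_L2 P U -> in_L2 P V -> in_L2 P (fun w => U w + V w).
Proof.
move=> [U1 U2] [V1 V2]; split.
  by under eq_fun do rewrite ReD; exact: Lfun2D.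
by under eq_fun do rewrite ImD; exact: Lfun2D.
Qed.

Lemma in_L2Z (c : R[i]) U : in_L2 P U -> in_L2 P (fun w => c * U w).
Proof.
move=> [U1 U2]; split.
  by under eq_fun do rewrite ReM; apply: Lfun2D; exact: Lfun2Z.
by under eq_fun do rewrite ImM; apply: Lfun2D; exact: Lfun2Z.
Qed.

(** Splitting into four real forms reduces sesquilinearity and Hermitian symmetry to bilinearity and
    symmetry of [dot]. *)
Lemma innerE U V : in_L2 P U -> in_L2 P V -> inner P U V =
  (dot P (re U) (re V) + dot P (im U) (im V)) +i*
  (dot P (im U) (re V) - dot P (re U) (im V)).
Proof.
move=> [U1 U2] [V1 V2]; rewrite /inner /cexpectation; congr (_ +i* _).
  rewrite /dot -ExpD; try exact: Lfun2_mul_Lfun1.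
  congr Exp; apply/funext => w.
  by case: (U w) (V w) => [a b] [c e] /=; rewrite mulrN opprK.
rewrite /dot -[X in _ = _ + X]mulN1r -ExpZ; last exact: Lfun2_mul_Lfun1.
rewrite -ExpD; try exact: Lfun2_mul_Lfun1; last first.
  under eq_fun do rewrite mulrA.
  by apply: Lfun2_mul_Lfun1 => //; exact: Lfun2Z.
congr Exp; apply/funext => w.
by case: (U w) (V w) => [a b] [c e] /=; rewrite mulrN mulN1r addrC.
Qed.

Lemma innerDl U V W : in_L2 P U -> in_L2 P V -> in_L2 P W ->
  inner P (fun w => U w + V w) W = inner P U W + inner P V W.
Proof.
move=> U2 V2 W2; rewrite !innerE//; last exact: in_L2D.
case: U2 V2 W2 => [Ur Ui] [Vr Vi] [Wr Wi].
rewrite (funext (fun w => ReD (U w) (V w))) (funext (fun w => ImD (U w) (V w))).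
rewrite !dotDl//; simpc; congr (_ +i* _); ring.
Qed.

Lemma innerZl c U W : in_L2 P U -> in_L2 P W ->
  inner P (fun w => c * U w) W = c * inner P U W.
Proof.
move=> U2 W2; rewrite !innerE//; last exact: in_L2Z.
case: U2 W2 => [Ur Ui] [Wr Wi].
rewrite (funext (fun w => ReM c (U w))) (funext (fun w => ImM c (U w))).
rewrite !dotDl ?dotZl ?Lfun2Z//; case: c => a b; simpc.
congr (_ +i* _); rewrite /=; ring.
Qed.

Lemma innerC U V : in_L2 P U -> in_L2 P V -> inner P V U = (inner P U V)^*.
Proof.
move=> U2 V2; rewrite !innerE//; simpc.
by congr (_ +i* _); rewrite ?[dot P _ (re U)]dotC ?[dot P _ (im U)]dotC.
Qed.

Lemma in_L2B U V : in_L2 P U -> in_L2 P V -> in_L2 P (fun w => U w - V w).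
Proof.
move=> U2 V2; rewrite (_ : (fun _ => _) = fun w => U w + -1 * V w).
  by apply: in_L2D => //; exact: in_L2Z.
by apply/funext => w; rewrite mulN1r.
Qed.

Lemma innerBr U V W : in_L2 P U -> in_L2 P V -> in_L2 P W ->
  inner P W (fun w => U w - V w) = inner P W U - inner P W V.
Proof.
move=> U2 V2 W2; rewrite (_ : (fun _ => _) = fun w => U w + -1 * V w).
  have NV2 := in_L2Z (-1) V2.
  rewrite (innerC (in_L2D U2 NV2) W2) innerDl// innerZl// mulN1r rmorphB.
  by rewrite (innerC U2 W2) (innerC V2 W2).
by apply/funext => w; rewrite mulN1r.
Qed.

Lemma inner_ae U U' V V' :
  in_L2 P U -> in_L2 P U' -> in_L2 P V -> in_L2 P V' ->
  U = U' %[ae P] -> V = V' %[ae P] -> inner P U V = inner P U' V'.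
Proof.
move=> U2 U'2 V2 V'2 UU' VV'; rewrite !innerE//.
case: U2 U'2 V2 V'2 => [? ?] [? ?] [? ?] [? ?].
congr ((_ + _) +i* (_ - _)); rewrite /dot; apply: Exp_ae;
  try (apply: measurable_funM; exact: (@Lfun2_measurable _ _ _ P));
  by apply: filterS2 UU' VV' => w /[swap] + /[swap] Tw => -> // ->.
Qed.

Lemma inner_self U : in_L2 P U -> inner P U U =
  (Exp P (fun w => complex.Re (U w) ^+ 2 + complex.Im (U w) ^+ 2))%:C.
Proof.
move=> U2; rewrite innerE//; case: U2 => Ur Ui.
rewrite [dot P _ (re U) in X in _ +i* X]dotC subrr complexr0 /dot -ExpD//;
  exact: Lfun2_mul_Lfun1.
Qed.

Lemma norm2_sqr U : in_L2 P U -> (norm2 P U ^+ 2)%:C = inner P U U.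
Proof.
move=> U2; rewrite inner_self// /norm2 -/(Exp _ _).
have -> : (fun w => ComplexField.Normc.normc (U w) ^+ 2) =
    (fun w => complex.Re (U w) ^+ 2 + complex.Im (U w) ^+ 2).
  apply/funext => w; case: (U w) => a b /=.
  by rewrite sqr_sqrtr ?addr_ge0 ?sqr_ge0.
rewrite sqr_sqrtr// fine_ge0// expectation_ge0// => w.
by rewrite addr_ge0 ?sqr_ge0.
Qed.

(** Definiteness: $E[(\mathrm{Re}\,U)^2+(\mathrm{Im}\,U)^2]=0$ forces $U=0$ almost surely, and a
    null variable is orthogonal to everything. Cauchy-Schwarz is thus avoided. *)
Lemma inner_self_eq0 U V : in_L2 P U -> in_L2 P V -> inner P U U = 0 ->
  inner P U V = 0.
Proof.
move=> U2 V2; rewrite inner_self// => /complexI U0.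
have Uae : U = (fun=> 0) %[ae P].
  have := Exp_eq0_ae _ _ U0; case: (U2) => Ur Ui.
  have sq1 : (fun w => complex.Re (U w) ^+ 2 + complex.Im (U w) ^+ 2)
      \in Lfun P 1.
    apply: (Lfun_addr_closed P (lexx _)).2; exact: Lfun2_mul_Lfun1.
  move=> /(_ sq1) h; have {}h := h (fun w => addr_ge0 (sqr_ge0 _) (sqr_ge0 _)).
  apply: filterS h => w /[apply] /=; case: (U w) => a b /= /eqP.
  by rewrite paddr_eq0 ?sqr_ge0// !sqrf_eq0 => /andP[/eqP-> /eqP->].
rewrite (inner_ae U2 in_L2_0 V2 V2 Uae (ae_eq_refl _ _ _)).
have := innerZl 0 in_L2_0 V2; under [X in inner P X]eq_fun do rewrite mul0r.
by rewrite mul0r.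
Qed.

End ComplexL2.

(** * Finite combinations of the $X_k$ and orthogonality to their span *)

Section LinearCombinations.
Context (d : measure_display) (Omega : measurableType d) (R : realType).
Variable P : probability Omega R.
Variable N : finType.
Variable X : N -> Omega -> R[i].
Hypothesis X2 : forall j, in_L2 P (X j).
Implicit Types (U V : Omega -> R[i]) (c : N -> R[i]) (S : {set N}).

Definition lincomb S c : Omega -> R[i] := fun w => \sum_(k in S) c k * X k w.

(** An arbitrary list and predicate replace the set [S] so that induction on the list goes
    through. *)
Lemma in_L2_sum (r : seq N) (p : pred N) c :
  in_L2 P (fun w => \sum_(k <- r | p k) c k * X k w).
Proof.
elim: r => [|k r IH].
  rewrite (_ : (fun _ => _) = fun=> 0); first exact: in_L2_0.
  by apply/funext => w; rewrite big_nil.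
rewrite (_ : (fun _ => _) = fun w => if p k then
    c k * X k w + \sum_(j <- r | p j) c j * X j w
  else \sum_(j <- r | p j) c j * X j w); last first.
  by apply/funext => w; rewrite big_cons.
by case: (p k) => //; apply: in_L2D => //; exact: in_L2Z.
Qed.

Lemma in_L2_lincomb S c : in_L2 P (lincomb S c).
Proof. exact: in_L2_sum. Qed.

Lemma inner_lincombl S c V : in_L2 P V ->
  inner P (lincomb S c) V = \sum_(k in S) c k * inner P (X k) V.
Proof.
move=> V2; rewrite /lincomb; elim: (index_enum N) => [|k r IH].
  (* The empty combination is written $0\cdot 0$ so that homogeneity gives inner product zero. *)
  rewrite big_nil (_ : (fun _ => _) = fun w => 0 * 0); last first.
    by apply/funext => w; rewrite big_nil mul0r.
  by rewrite (innerZl 0 (in_L2_0 P) V2) mul0r.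
rewrite big_cons (_ : (fun _ => _) = fun w => if k \in S then
    c k * X k w + \sum_(j <- r | j \in S) c j * X j w
  else \sum_(j <- r | j \in S) c j * X j w); last first.
  by apply/funext => w; rewrite big_cons.
case: (k \in S) => //; rewrite innerDl ?innerZl ?IH//; last exact: in_L2_sum.
exact: in_L2Z.
Qed.

Lemma inner_lincombr S c U : in_L2 P U ->
  inner P U (lincomb S c) = \sum_(k in S) (c k)^* * inner P U (X k).
Proof.
move=> U2; rewrite innerC//; last exact: in_L2_lincomb.
rewrite inner_lincombl// rmorph_sum; apply: eq_bigr => k _.
by rewrite (innerC (X2 k) U2) rmorphM.
Qed.

Lemma in_sp_lincomb S c : in_sp P X S (lincomb S c).
Proof.
by split; [exact: in_L2_lincomb | exists c; exact: ae_eq_refl].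
Qed.

Lemma in_sp_gen S k : k \in S -> in_sp P X S (X k).
Proof.
move=> kS; split => //; exists (fun j => (j == k)%:R).
apply: aeW => w _; rewrite (bigD1 k)//= eqxx mul1r big1 ?addr0// => j /andP[_].
by move=> /negbTE ->; rewrite mul0r.
Qed.

(** By conjugate linearity in the second argument, orthogonality to the span need only be tested on
    the finitely many generators. *)
Lemma orthogonal_sp S U : in_L2 P U ->
  (forall k, k \in S -> inner P U (X k) = 0) ->
  forall W, in_sp P X S W -> inner P U W = 0.
Proof.
move=> U2 U0 W [W2 [c Wc]].
rewrite (inner_ae U2 U2 W2 (in_L2_lincomb S c) (ae_eq_refl _ _ _) Wc).
rewrite inner_lincombr// big1// => k kS.
by rewrite U0// mulr0.
Qed.

(** * The inverse covariance matrix, its principal submatrices and the linear system *)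

Section Covariance.
Hypothesis covU : covmx P X \in unitmx.

Lemma cov_invcov i j :
  \sum_k inner P (X i) (X k) * invcov P X k j = (i == j)%:R.
Proof.
have /matrixP/(_ (enum_rank i) (enum_rank j)) := mulmxV covU.
rewrite !mxE (inj_eq enum_rank_inj) => <-.
rewrite (reindex enum_rank) /=; last exact/onW_bij/enum_rank_bij.
by apply: eq_bigr => k _; rewrite mxE !enum_rankK.
Qed.

Lemma invcov_cov i j :
  \sum_k invcov P X i k * inner P (X k) (X j) = (i == j)%:R.
Proof.
have /matrixP/(_ (enum_rank i) (enum_rank j)) := mulVmx covU.
rewrite !mxE (inj_eq enum_rank_inj) => <-.
rewrite (reindex enum_rank) /=; last exact/onW_bij/enum_rank_bij.
by apply: eq_bigr => k _; rewrite mxE !enum_rankK.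
Qed.

(** The row of inner products of $\sum_i c_iX_i$ with the $X_j$ is $c\Gamma$; multiplying by
    $\Gamma^{-1}$ on the right recovers $c$. *)
Lemma lincomb_coef c k : c k =
  \sum_j inner P (lincomb [set: N] c) (X j) * invcov P X j k.
Proof.
transitivity (\sum_i c i * (i == k)%:R).
  rewrite (bigD1 k)//= eqxx mulr1 big1 ?addr0// => j /negbTE ->.
  by rewrite mulr0.
under eq_bigr do rewrite -cov_invcov mulr_sumr.
rewrite exchange_big /=; apply: eq_bigr => j _.
rewrite inner_lincombl// mulr_suml; under [RHS]eq_bigl do rewrite inE.
by apply: eq_bigr => i _; rewrite mulrA.
Qed.

(** With [v] extended by zero outside [S], the inner products form the row
    $v\Gamma^{-1}\Gamma=v$. *)
Lemma inner_lincomb_invcov S (v : N -> R[i]) j :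
  inner P (lincomb [set: N] (fun k => \sum_(i in S) v i * invcov P X i k)) (X j)
  = if j \in S then v j else 0.
Proof.
rewrite inner_lincombl//; under eq_bigl do rewrite inE.
under eq_bigr do rewrite mulr_suml.
rewrite exchange_big /=.
transitivity (\sum_(i in S) v i * (i == j)%:R).
  apply: eq_bigr => i _; rewrite -invcov_cov mulr_sumr.
  by apply: eq_bigr => k _; rewrite mulrA.
rewrite big_mkcond (bigD1 j)//= eqxx mulr1 big1 ?addr0// => i /negbTE ->.
by rewrite mulr0 if_same.
Qed.

Lemma lincombT_sub S c : (forall k, k \notin S -> c k = 0) ->
  lincomb [set: N] c = lincomb S c.
Proof.
move=> c0; apply/funext => w; rewrite /lincomb [RHS]big_mkcond /=.
under eq_bigl do rewrite inE.
by apply: eq_bigr => k _; case: ifPn => // /c0 ->; rewrite mul0r.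
Qed.

(* If v (gamma^{i,j})_{i,j in S} = 0, the combination of X with coefficients
   v Gamma^{-1} only involves the X_k with k outside S, to which it is
   orthogonal: hence it vanishes, while its products with the X_j are v. *)
Lemma invcov_sub_inj S (v : N -> R[i]) :
  (forall j, j \in S -> \sum_(i in S) v i * invcov P X i j = 0) ->
  forall j, j \in S -> v j = 0.
Proof.
move=> v0 j jS; pose c k := \sum_(i in S) v i * invcov P X i k.
have cS : lincomb [set: N] c = lincomb (~: S) c.
  by apply: lincombT_sub => k; rewrite inE negbK; exact: v0.
have := inner_lincomb_invcov S v j; rewrite jS => <-.
apply: inner_self_eq0 => //; first exact: in_L2_lincomb.
rewrite [in X in inner P _ X]cS inner_lincombr; last exact: in_L2_lincomb.
rewrite big1// => k; rewrite inE => /negbTE kS.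
by rewrite inner_lincomb_invcov kS mulr0.
Qed.

(** A square matrix with trivial left kernel is invertible; the kernel is trivial by
    [invcov_sub_inj], once a row vector is read as a function on [S]. *)
Lemma invcov_submx_unit S : invcov_submx P X S \in unitmx.
Proof.
rewrite -row_free_unit; apply: inj_row_free => v vB0.
(* Indexing by [enum_rank_in] needs an element of [S], so the empty set, where rows have no entries,
   is treated apart. *)
have [S0|[x0 x0S]] := set_0Vmem S.
  by apply/rowP => -[i hi]; exfalso; move: hi; rewrite S0 cards0.
pose u i := v 0 (enum_rank_in x0S i).
have u0 : forall j, j \in S -> u j = 0.
  apply: invcov_sub_inj => j jS.
  have /rowP/(_ (enum_rank_in x0S j)) := vB0.
  rewrite !mxE; apply: etrans; rewrite [LHS]big_enum_val/=.
  by apply: eq_bigr => i _; rewrite /u mxE enum_valK_in enum_rankK_in.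
apply/rowP => i; rewrite mxE -(enum_valK_in x0S i).
exact: (u0 _ (enum_valP i)).
Qed.

(** With $B$ the submatrix, the system reads $vB=e_l$, so $v=e_lB^{-1}$ is row $l$ of $B^{-1}$. The
    case [i = l] gives the diagonal entry for the error variance. *)
Lemma solves_row S l (lS : l \in S) a : solves P X S l a ->
  forall i, i \in S ->
  a i = invmx (invcov_submx P X S) (enum_rank_in lS l) (enum_rank_in lS i).
Proof.
move=> sola i iS; pose v := \row_(i < #|S|) a (enum_val i).
have vB : v *m invcov_submx P X S = row (enum_rank_in lS l) 1%:M.
  apply/rowP => j; rewrite !mxE.
  rewrite -(inj_eq enum_val_inj) enum_rankK_in// -(sola _ (enum_valP j)).
  by rewrite [RHS]big_enum_val/=; apply: eq_bigr => k _; rewrite !mxE.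
have : v = row (enum_rank_in lS l) (invmx (invcov_submx P X S)).
  by rewrite -[LHS](mulmxK (invcov_submx_unit S)) vB -row_mul mul1mx.
by move=> /rowP/(_ (enum_rank_in lS i)); rewrite !mxE enum_rankK_in.
Qed.

(** The difference of two solutions solves the homogeneous system. *)
Lemma solves_uniq S l a b : solves P X S l a -> solves P X S l b ->
  {in S, a =1 b}.
Proof.
move=> sa sb i iS; apply/eqP; rewrite -subr_eq0; apply/eqP.
apply: (invcov_sub_inj (S := S) (v := fun i => a i - b i)) => // j jS.
by under eq_bigr do rewrite mulrBl; rewrite sumrB sa// sb// subrr.
Qed.

Lemma solves_ex S l : l \in S -> exists a, solves P X S l a.
Proof.
move=> lS; pose B := invcov_submx P X S.
(* The solution is row $l$ of the inverse submatrix. *)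
exists (fun i => invmx B (enum_rank_in lS l) (enum_rank_in lS i)) => j jS.
have /matrixP/(_ (enum_rank_in lS l) (enum_rank_in lS j)) :=
  mulVmx (invcov_submx_unit S).
rewrite !mxE -(inj_eq enum_val_inj) !enum_rankK_in// => <-.
rewrite [LHS]big_enum_val/=; apply: eq_bigr => i _.
by rewrite mxE enum_valK_in enum_rankK_in.
Qed.

End Covariance.

(** * The dual expressed through the inverse covariance matrix *)

Section Dual.
Variable Y : N -> Omega -> R[i].
Hypothesis XY : is_dual P X Y.

(** Expanding $Y_j=\sum_k c_{j,k}X_k$ turns biorthogonality into $\Gamma C=I$ with
    $C_{k,j}=\overline{c_{j,k}}$, and a one-sided inverse of a square matrix suffices. *)
Lemma dual_covmx_unit : covmx P X \in unitmx.
Proof.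
case: XY => _ Ysp bi; have [c Yc] := choice (fun j => (Ysp j).2).
pose C := \matrix_(k, j < #|N|) (c (enum_val j) (enum_val k))^*.
have /mulmx1_unit[] // : covmx P X *m C = 1%:M.
apply/matrixP => i j; rewrite !mxE -(inj_eq enum_val_inj) -bi.
rewrite (inner_ae (X2 _) (X2 _) (Ysp _).1 (in_L2_lincomb _ _)
  (ae_eq_refl _ _ _) (Yc (enum_val j))) inner_lincombr//.
rewrite [RHS](eq_bigl predT) => [|k]; last by rewrite inE.
rewrite [RHS](reindex (@enum_val N predT)) /=; last exact/onW_bij/enum_val_bij.
by apply: eq_bigr => k _; rewrite !mxE mulrC.
Qed.

(** The coefficients of $Y_i$ are recovered from its inner products with the $X_j$, which are
    $\delta_{ij}$: only row $i$ of $\Gamma^{-1}$ survives. *)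
Lemma dualE i : Y i = lincomb [set: N] (invcov P X i) %[ae P].
Proof.
case: XY => _ Ysp bi; have [Y2 [c Yc]] := Ysp i.
suff -> : invcov P X i = c by [].
apply/funext => k; rewrite (lincomb_coef dual_covmx_unit c k).
rewrite (bigD1 i)//= big1 ?addr0 => [|j ji]; rewrite innerC;
  rewrite ?(inner_ae (X2 _) (X2 _) (in_L2_lincomb _ _) Y2
  (ae_eq_refl _ _ _) (ae_eq_sym Yc)) ?bi; try by [|exact: in_L2_lincomb].
  by rewrite eqxx rmorph1 mul1r.
by rewrite (negbTE ji) rmorph0 mul0r.
Qed.

Lemma sum_dualE S (v : N -> R[i]) :
  (fun w => \sum_(i in S) v i * Y i w) =
  lincomb [set: N] (fun k => \sum_(i in S) v i * invcov P X i k) %[ae P].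
Proof.
(* As [N] is finite, a single null set serves all indices. *)
have : \forall w \ae P, forall i, Y i w = lincomb [set: N] (invcov P X i) w.
  apply: filter_forall => i.
  by have := dualE i; apply: filterS => w; exact.
apply: filterS => w Yw _; rewrite /lincomb; under eq_bigr do rewrite Yw mulr_sumr.
rewrite exchange_big /=; apply: eq_bigr => k _; rewrite mulr_suml.
by apply: eq_bigr => i _; rewrite mulrA.
Qed.

End Dual.

End LinearCombinations.

(** * The residual and the predictor, with [A] the complement of [K] *)

Section Predictor.
Context (d : measure_display) (Omega : measurableType d) (R : realType).
Variable P : probability Omega R.
Variable N : finType.
Variable X : N -> Omega -> R[i].
Hypothesis X2 : forall j, in_L2 P (X j).
Hypothesis covU : covmx P X \in unitmx.
Variables (l : N) (K A : {set N}).
Hypotheses (lK : l \notin K) (KA : A = ~: K).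
Implicit Types (a b : N -> R[i]).

Definition predcoef a k := - \sum_(i in A) a i * invcov P X i k.

Lemma target_in_complement : l \in A. Proof. by rewrite KA inE. Qed.

(** These are the coefficients over all of [N] of the residual $X_l-\sum_{k\in K}b_kX_k$; masking
    [b] outside [K] makes [residualE] hold at every point. *)
Definition rescoef b k : R[i] := (k == l)%:R - (if k \in K then b k else 0).

Lemma residualE b w : X l w - lincomb X K b w = lincomb X [set: N] (rescoef b) w.
Proof.
rewrite /lincomb; under [RHS]eq_bigl do rewrite inE.
under [RHS]eq_bigr do rewrite mulrBl.
rewrite sumrB [X in _ = X - _](bigD1 l)//= eqxx mul1r.
rewrite [X in _ = _ + X - _]big1 ?addr0 => [|j /negbTE->]; last by rewrite mul0r.
congr (_ - _); rewrite [LHS]big_mkcond /=; apply: eq_bigr => k _.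
by case: ifP => // _; rewrite mul0r.
Qed.

Lemma rescoef_in b k : k \in K -> rescoef b k = - b k.
Proof.
move=> kK; rewrite /rescoef kK; case: eqP => [kl|_]; last by rewrite sub0r.
by move: lK; rewrite -kl kK.
Qed.

Lemma rescoef_notin b k : k \in A -> rescoef b k = (l == k)%:R.
Proof. by rewrite KA inE /rescoef => /negbTE ->; rewrite subr0 eq_sym. Qed.

(** On [K] this is the choice of [predcoef]; on [A] it is exactly the linear system. *)
Lemma rescoef_predcoef a : solves P X A l a ->
  rescoef (predcoef a) = fun k => \sum_(i in A) a i * invcov P X i k.
Proof.
move=> sa; apply/funext => k; have [kK|kK] := boolP (k \in K).
  by rewrite rescoef_in// opprK.
have kA : k \in A by rewrite KA inE.
by rewrite rescoef_notin// sa.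
Qed.

(** The residual of the candidate has coefficients $a\Gamma^{-1}$, so its inner products with the
    $X_k$ are [a] extended by zero, hence vanish on [K]. *)
Lemma predictor_ex a : solves P X A l a ->
  is_predictor P X l K (lincomb X K (predcoef a)).
Proof.
move=> sa; split; first exact: in_sp_lincomb.
rewrite (funext (residualE (predcoef a))) rescoef_predcoef//.
apply: orthogonal_sp => // [|k kK]; first exact: in_L2_lincomb.
by rewrite inner_lincomb_invcov// KA inE kK.
Qed.

(** The representation [b] is arbitrary, so this also shows that the coefficients on [K] are
    determined. *)
Lemma predictor_coef Xhat a b : is_predictor P X l K Xhat ->
  solves P X A l a -> Xhat = lincomb X K b %[ae P] ->
  [/\ {in K, b =1 predcoef a} &
      inner P (fun w => X l w - Xhat w) (X l) = a l].
Proof.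
move=> [[Xh2 _] Xhorth] sa Xhb; pose res w := X l w - Xhat w.
have res2 : in_L2 P res by exact: in_L2B.
have resE : res = lincomb X [set: N] (rescoef b) %[ae P].
  by apply: filterS Xhb => w /[apply] Xw; rewrite -residualE /res Xw.
have innE j : inner P (lincomb X [set: N] (rescoef b)) (X j) = inner P res (X j).
  exact: (inner_ae (in_L2_lincomb X2 _ _) res2 (X2 j) (X2 j) (ae_eq_sym resE)
    (ae_eq_refl _ _ _)).
(* Orthogonality to the $X_j$ with [j] in [K] cuts the sum recovering the coefficients down to
   [A]. *)
have cE k : rescoef b k = \sum_(j in A) inner P res (X j) * invcov P X j k.
  rewrite (lincomb_coef X2 covU) [RHS]big_mkcond /=; apply: eq_bigr => i _.
  rewrite innE; case: ifPn => //; rewrite KA inE negbK => iK.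
  by rewrite Xhorth ?mul0r//; exact: in_sp_gen.
(* For an index in [A] the residual coefficient is a Kronecker delta, so the previous identity
   becomes the system; uniqueness then identifies the inner products with [a]. *)
have sres : solves P X A l (fun j => inner P res (X j)).
  by move=> j jA; rewrite -cE rescoef_notin.
have resa := solves_uniq X2 covU sres sa.
split => [k kK|]; last exact/resa/target_in_complement.
apply: oppr_inj; rewrite -(rescoef_in b)// cE opprK.
by apply: eq_bigr => i iA; rewrite resa.
Qed.

End Predictor.

Theorem lemma2p5 (d : measure_display) (Omega : measurableType d)
  (R : realType) (P : probability Omega R)
  (N : finType) (X Y : N -> Omega -> R[i])
  (K M : {set N}) (l : N)
  (hX : in_H P X) (hY : is_dual P X Y)
  (hN : K :|: [set l] :|: M = [set: N])
  (hlK : l \notin K) (hlM : l \notin M) (hKM : [disjoint K & M]) :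
  [/\ covmx P X \in unitmx /\ invcov_submx P X (l |: M) \in unitmx,
      exists Xhat, is_predictor P X l K Xhat,
      exists a', solves P X (l |: M) l a',
      forall a' b', solves P X (l |: M) l a' -> solves P X (l |: M) l b' ->
        {in l |: M, a' =1 b'}
    & forall (Xhat : Omega -> R[i]) (a' : N -> R[i]),
        is_predictor P X l K Xhat -> solves P X (l |: M) l a' ->
        [/\ (fun w => X l w - Xhat w)
              = (fun w => \sum_(i in l |: M) a' i * Y i w) %[ae P],
            (norm2 P (fun w => X l w - Xhat w) ^+ 2)%:C = a' l,
            (norm2 P (fun w => X l w - Xhat w) ^+ 2)%:C
              = invmx (invcov_submx P X (l |: M))
                  (enum_rank_in (setU11 l M) l) (enum_rank_in (setU11 l M) l),
            forall a : N -> R[i],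
              Xhat = (fun w => \sum_(k in K) a k * X k w) %[ae P] ->
              forall k, k \in K ->
                a k = - \sum_(i in l |: M) a' i * invcov P X i k
          & Xhat = (fun w => - \sum_(k in K)
                      (\sum_(i in l |: M) a' i * invcov P X i k) * X k w)
              %[ae P]]].
Proof.
have X2 j : in_L2 P (X j) := (hX j).1.
have covU := dual_covmx_unit X2 hY.
(* The partition enters the rest of the argument only through this equality and [hlK]. *)
have KA : l |: M = ~: K.
  apply/setP => k; rewrite !inE.
  have : k \in K :|: [set l] :|: M by rewrite hN inE.
  rewrite !inE.
  have [kK _|kK] := boolP (k \in K); last by rewrite orFb.
  rewrite (disjointFr hKM kK) orbF; apply/negbTE.
  by apply: contraNneq hlK => <-.
have lA := setU11 l M.
have [a0 sa0] := solves_ex X2 covU lA.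
split.
- by split=> //; exact: invcov_submx_unit.
- by exists (lincomb X K (predcoef P X (l |: M) a0)); exact: predictor_ex.
- by exists a0.
- by move=> a b; exact: solves_uniq.
move=> Xhat a Xp sa; have [[Xh2 [b Xhb]] Xhorth] := Xp.
have [bE innl] := predictor_coef X2 covU hlK KA Xp sa Xhb.
have XhE : Xhat = lincomb X K (predcoef P X (l |: M) a) %[ae P].
  apply: filterS Xhb => w /[apply] ->.
  by apply: eq_bigr => k kK; rewrite bE.
have res2 : in_L2 P (fun w => X l w - Xhat w) by exact: in_L2B.
(* The squared norm is the inner product of the residual with $X_l-\hat X_l(K)$; the part with $\hat
   X_l(K)$ vanishes because the predictor lies in the span. *)
have normE : (norm2 P (fun w => X l w - Xhat w) ^+ 2)%:C = a l.
  by rewrite norm2_sqr// innerBr// (Xhorth _ Xp.1) subr0.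
split => //.
(* Both sides equal the combination of the $X_k$ with coefficients $a'\Gamma^{-1}$. *)
- apply: filterS2 XhE (sum_dualE X2 hY (l |: M) a) => w + + Tw.
  move=> /(_ Tw) -> /(_ Tw) ->.
  by rewrite residualE// (rescoef_predcoef hlK KA sa).
- by rewrite normE; exact: solves_row.
- move=> b' Xhb' k kK.
  by have [+ _] := predictor_coef X2 covU hlK KA Xp sa Xhb'; apply.
- apply: filterS XhE => w /[apply] ->; rewrite /lincomb -sumrN.
  by apply: eq_bigr => k _; rewrite mulNr.
Qed.
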